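(* Let $T>0$, $I=[0,T]$, let $f\in\mathcal{C}(I)$, let $\kappa\in\mathscr{K}_{\mathrm{reg}}$ be a regular admissible kernel and let $\Lambda\in\mathscr{A}(I)$ be an adaptive sensitivity function. For $t\in I$ let $$\mathcal{J}_f(t):=\int_0^t\Lambda(s,f(s))\,\kappa(t-s)\,|f(s)|\,ds,\qquad \mathcal{M}_f(t):=|f(t)|+\mathcal{J}_f(t).$$ Then: (i) For every $t\in I$, the integral defining $\mathcal{J}_f(t)$ converges absolutely as a Lebesgue integral. Consequently $\mathcal{J}_f(t)$ is a finite, non-negative real number for all $t\in I$, and $\mathcal{M}_f(t)$ is likewise finite and non-negative. (ii) The mappings $t\mapsto\mathcal{J}_f(t)$ and $t\mapsto\mathcal{M}_f(t)$ are Lebesgue measurable on $I$. (iii) There exists a finite constant $C>0$, independent of $f$ and $t$, such that $\mathcal{M}_f(t)\le C\|f\|_\infty$ for all $t\in I$. More explicitly, one may take $C:=1+\Lambda_\infty\kappa_\infty T$, where $$\Lambda_\infty:=\sup_{(s,x)\in I\times\mathbb{R}}\Lambda(s,x)\le\lambda_{\max}<\infty,\qquad \kappa_\infty:=\sup_{\tau\in I}\kappa(\tau)\le M_\kappa<\infty,$$ with $\lambda_{\max}$ and $M_\kappa$ the upper bounds in the definitions of $\mathscr{A}(I)$ and $\mathscr{K}_{\mathrm{reg}}$. One also has $\mathcal{J}_f(t)\le\Lambda_\infty\kappa_\infty T\|f\|_\infty$ for all $t\in I$.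
   Context: Fix $T>0$ and $I=[0,T]$. $\mathcal{C}(I)$ is the set of continuous functions $I\to\mathbb{R}$ and $\|f\|_\infty:=\sup_{t\in I}|f(t)|$. Regular admissible kernels: $\mathscr{K}_{\mathrm{reg}}$ is the set of Lebesgue measurable, integrable functions $\kappa:I\to[0,\infty)$ such that (uniform boundedness) there are constants $0<m_\kappa\le M_\kappa<\infty$ with $m_\kappa\le\kappa(\tau)\le M_\kappa$ for all $\tau\in I$; (normalization) $\int_0^T\kappa(\tau)\,d\tau=1$; (Lipschitz continuity) there is $L_\kappa>0$ with $|\kappa(\tau_1)-\kappa(\tau_2)|\le L_\kappa|\tau_1-\tau_2|$ for all $\tau_1,\tau_2\in I$. Adaptive sensitivity functions: $\mathscr{A}(I)$ is the set of functions $\Lambda:I\times\mathbb{R}\to[0,\infty)$ such that: there are constants $0<\lambda_{\min}\le\lambda_{\max}<\infty$ with $\lambda_{\min}\le\Lambda(s,x)\le\lambda_{\max}$ for all $(s,x)\in I\times\mathbb{R}$; there is $L_\Lambda>0$ with $|\Lambda(s,x)-\Lambda(s,y)|\le L_\Lambda|x-y|$ for all $s\in I$, $x,y\in\mathbb{R}$; for every fixed $x\in\mathbb{R}$, $s\mapsto\Lambda(s,x)$ is Lebesgue measurable on $I$; there is $\varrho>0$ with $\Lambda(s,0)\ge\varrho$ for all $s\in I$. *)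

(* Defs.v *)
From HB Require Import structures.
From mathcomp Require Import all_boot all_order all_algebra.
From mathcomp Require Import all_classical all_reals all_analysis.
From mathcomp Require Import measurable_realfun.

Set Implicit Arguments.
Unset Strict Implicit.
Unset Printing Implicit Defensive.

Import Order.TTheory GRing.Theory Num.Theory.
Import numFieldNormedType.Exports.

Local Open Scope classical_set_scope.
Local Open Scope ring_scope.

(* R with the sigma-algebra of Lebesgue (not merely Borel) measurable sets, i.e.
   the domain of [completed_lebesgue_measure]; its carrier is convertible to R.
   Targets of measurable functions keep the Borel sigma-algebra. *)
Notation lebesgueType R :=
  (caratheodory_type (@wlength R idfun)^*%mu) (only parsing).
Notation clebesgue R := (@completed_lebesgue_measure R) (only parsing).

(* Functions on I = [0, T] are represented by total functions on R, about which
   nothing is assumed outside I. *)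

Definition lebesgue_measurable_on (R : realType) (D : set R) (g : R -> R) :=
  @measurable_fun _ _ (lebesgueType R) (measurableTypeR R) D g.

Definition lebesgue_emeasurable_on (R : realType) (D : set R)
    (g : R -> \bar R) :=
  @measurable_fun _ _ (lebesgueType R) (\bar R) D g.

Definition kernel_bounds (R : realType) (T : R) (kappa : R -> R) (m M : R) :=
  0 < m <= M /\ forall tau, tau \in `[0, T] -> m <= kappa tau <= M.

Record regular_kernel (R : realType) (T : R) (kappa : R -> R) : Prop := {
  rk_ge0 : forall tau, tau \in `[0, T] -> 0 <= kappa tau ;
  rk_measurable : lebesgue_measurable_on `[0, T] kappa ;
  rk_integrable : (clebesgue R).-integrable `[0, T] (EFin \o kappa) ;
  rk_bounds : exists m M, kernel_bounds T kappa m M ;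
  rk_normalized : (\int[clebesgue R]_(tau in `[0%R, T]) (kappa tau)%:E = 1)%E ;
  rk_lipschitz : exists2 L, 0 < L &
    forall tau1 tau2, tau1 \in `[0, T] -> tau2 \in `[0, T] ->
      `|kappa tau1 - kappa tau2| <= L * `|tau1 - tau2| }.

Definition sensitivity_bounds (R : realType) (T : R) (Lambda : R -> R -> R)
    (lmin lmax : R) :=
  0 < lmin <= lmax /\
  forall s x, s \in `[0, T] -> lmin <= Lambda s x <= lmax.

Record adaptive_sensitivity (R : realType) (T : R) (Lambda : R -> R -> R)
    : Prop := {
  as_ge0 : forall s x, s \in `[0, T] -> 0 <= Lambda s x ;
  as_bounds : exists lmin lmax, sensitivity_bounds T Lambda lmin lmax ;
  as_lipschitz : exists2 L, 0 < L &
    forall s x y, s \in `[0, T] ->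
      `|Lambda s x - Lambda s y| <= L * `|x - y| ;
  as_measurable : forall x, lebesgue_measurable_on `[0, T] (Lambda ^~ x) ;
  as_nondegenerate : exists2 rho, 0 < rho &
    forall s, s \in `[0, T] -> rho <= Lambda s 0 }.

Definition memory_integrand (R : realType) (kappa : R -> R)
    (Lambda : R -> R -> R) (f : R -> R) (t s : R) : R :=
  Lambda s (f s) * kappa (t - s) * `|f s|.

(* Extended-real valued, so that finiteness is a genuine claim. *)
Definition memory_integral (R : realType) (kappa : R -> R)
    (Lambda : R -> R -> R) (f : R -> R) (t : R) : \bar R :=
  (\int[clebesgue R]_(s in `[0%R, t]) (memory_integrand kappa Lambda f t s)%:E)%E.

Definition memory_operator (R : realType) (kappa : R -> R)
    (Lambda : R -> R -> R) (f : R -> R) (t : R) : \bar R :=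
  (`|f t|%:E + memory_integral kappa Lambda f t)%E.

Definition sup_norm (R : realType) (T : R) (f : R -> R) : R :=
  sup [set `|f t| | t in `[0, T]].

Definition kernel_range (R : realType) (T : R) (kappa : R -> R) : set R :=
  [set kappa tau | tau in `[0, T]].

Definition sensitivity_range (R : realType) (T : R) (Lambda : R -> R -> R)
    : set R :=
  [set Lambda s x | s in `[0, T] & x in [set: R]].

(* Main.v *)
Require Import Defs.
From HB Require Import structures.
From mathcomp Require Import all_boot all_order all_algebra.
From mathcomp Require Import all_classical all_reals all_analysis.
From mathcomp Require Import measurable_realfun.
From mathcomp Require Import ring lra.

Set Implicit Arguments.
Unset Strict Implicit.
Unset Printing Implicit Defensive.

Import Order.TTheory GRing.Theory Num.Theory.
Import numFieldNormedType.Exports.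

Local Open Scope classical_set_scope.
Local Open Scope ring_scope.

(** The integrand s |-> Lambda s (f s) * kappa (t - s) * |f s| is a product of
three factors that lie between 0 and the suprema over [0, T] of Lambda, kappa
and |f|.  Once it is known to be Lebesgue measurable in s, comparison with a
constant over an interval of length t <= T gives integrability, finiteness and
all the bounds.  The two real issues are of measurability.

Measurability of s |-> Lambda s (f s) ([measurable_fun_caratheodory]).
Lambda is only measurable in its first variable, but it is L-Lipschitz in
the second one uniformly in the first, hence Lambda s (f s) is the
infimum over the rationals q of Lambda s q + L * |f s - q|, a countable infimum
of measurable functions.

Measurability of t |-> J t ([memory_integral_one_sided_lipschitz],
[measurable_fun_one_sided_lipschitz]).  If x <= y, the Lipschitz bound on
kappa compares the integrands at x and at y on [0, x], and extending the domain
from [0, x] to [0, y] can only increase the integral of a nonnegative function;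
so J x <= J y + K * (y - x) for a constant K.  This says that J t + K * t is
nondecreasing, and monotone functions are Borel measurable.  The same criterion
gives the measurability of s |-> kappa (t - s). *)

(** * Lebesgue and Borel measurability *)

Lemma lebesgue_measurable_borel (R : realType) (D : set R) :
  @measurable _ (measurableTypeR R) D -> @measurable _ (lebesgueType R) D.
Proof. exact: sub_caratheodory. Qed.

Lemma borel_lebesgue_measurable_fun (R : realType) d (U : measurableType d)
    (D : set R) (g : R -> U) :
  @measurable _ (measurableTypeR R) D ->
  @measurable_fun _ _ (measurableTypeR R) U D g ->
  @measurable_fun _ _ (lebesgueType R) U D g.
Proof.
by move=> mD mg _ Y mY; apply: lebesgue_measurable_borel; exact: mg.
Qed.

Lemma clebesgue_itvcc (R : realType) (a b : R) : a <= b ->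
  clebesgue R `[a, b] = (b - a)%:E.
Proof.
(* Both measures are restrictions of the same outer measure. *)
move=> ab; have -> : clebesgue R `[a, b] = lebesgue_measure `[a, b] by [].
rewrite lebesgue_measure_itv /= lte_fin EFinB.
by case: ltgtP ab => // -> _; rewrite -EFinB subrr.
Qed.

(** The hypothesis says that g x + K * x is nondecreasing on [a, b], so g is the
difference of a monotone function and a linear one. *)
Lemma measurable_fun_one_sided_lipschitz (R : realType) (a b K : R)
    (g : R -> R) :
  (forall x y, a <= x -> x <= y -> y <= b -> g x <= g y + K * (y - x)) ->
  @measurable_fun _ _ (measurableTypeR R) (measurableTypeR R) `[a, b] g.
Proof.
move=> gK; have [ab|ba] := leP a b; last first.
  rewrite set_itv_ge -?leNgt ?bnd_simp -?ltNge//; exact: measurable_fun_set0.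
(* Precomposing with the retraction of the line onto [a, b] makes the monotone
   function monotone on the whole line. *)
pose clamp x := Num.max a (Num.min b x).
have clampE x : x \in `[a, b] -> clamp x = x.
  by rewrite in_itv/= => /andP[ax xb]; rewrite /clamp min_r// max_r.
pose h x := g (clamp x) + K * clamp x.
have mh : @measurable_fun _ _ (measurableTypeR R) (measurableTypeR R) `[a, b] h.
  apply: nondecreasing_measurable => // x y xy; rewrite /h.
  have cxy : clamp x <= clamp y.
    by rewrite /clamp ge_max !le_max lexx/= le_min !ge_min lexx xy !orbT.
  have := gK (clamp x) (clamp y); rewrite {1}/clamp le_max lexx => /(_ isT cxy).
  by rewrite {1}/clamp ge_max ab ge_min lexx => /(_ isT); lra.
apply: (eq_measurable_fun (h \- (fun x => K * x))).
  by move=> x; rewrite inE /h/= => /clampE ->; rewrite addrK.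
apply: measurable_funB => //.
by apply: measurable_funM.
Qed.

(** By the Lipschitz bound, Lambda s (f s) < a exactly when
Lambda s q + L * |f s - q| < a for some rational q, which writes each
sublevel set as a countable union of measurable sets. *)
Lemma measurable_fun_caratheodory d (S : measurableType d) (R : realType)
    (D : set S) (Lambda : S -> R -> R) (L : R) (f : S -> R) :
  0 < L ->
  (forall s x y, D s -> `|Lambda s x - Lambda s y| <= L * `|x - y|) ->
  (forall x, measurable_fun D (Lambda ^~ x)) ->
  measurable_fun D f ->
  measurable_fun D (fun s => Lambda s (f s)).
Proof.
move=> L0 lipL mL mf mD.
apply: (measurability _ (RGenInftyO.measurableE R)) => //.
move=> /= _ [_ [a ->] <-].
pose h (q : rat) s := Lambda s (ratr q) + L * `|f s - ratr q|.
have -> : D `&` (fun s => Lambda s (f s)) @^-1` `]-oo, a[ =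
    \bigcup_(q : rat) (D `&` h q @^-1` `]-oo, a[).
  apply/seteqP; split=> s /=.
  - move=> [Ds]; rewrite in_itv/= => fa.
    (* If |f s - q| < e then Lambda s q + L * |f s - q| exceeds Lambda s (f s)
       by less than 2 * L * e, the gap to a. *)
    pose e := (a - Lambda s (f s)) / (2 * L).
    have e0 : 0 < e by rewrite divr_gt0 ?subr_gt0 ?mulr_gt0.
    have [q] := @rat_in_itvoo R (f s - e) (f s + e) ltac:(lra).
    rewrite in_itv/= => /andP[q1 q2]; exists q => //; split => //=.
    rewrite in_itv/= /h.
    have : `|f s - ratr q| < e by rewrite ltr_norml; apply/andP; split; lra.
    rewrite /e ltr_pdivlMr ?mulr_gt0// => ?.
    have := lipL s (ratr q) (f s) Ds; rewrite (distrC (ratr q)).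
    by move=> /(le_trans (ler_norm _)); lra.
  - move=> [q _ [Ds]]/=; rewrite !in_itv/= => ha; split => //.
    apply: le_lt_trans ha; rewrite /h -lerBlDl.
    exact: le_trans (ler_norm _) (lipL _ _ _ Ds).
apply: bigcupT_measurable_rat => q.
have mh : measurable_fun D (h q).
  apply: measurable_funD; first exact: mL.
  apply: measurable_funM; first exact: measurable_cst.
  apply: measurableT_comp; first exact: normr_measurable.
  by apply: measurable_funB => //; exact: measurable_cst.
exact: mh.
Qed.

(** * Suprema of the data *)

Lemma le_sup_sensitivity (R : realType) (T : R) (Lambda : R -> R -> R) s x :
  has_sup (sensitivity_range T Lambda) -> s \in `[0, T] ->
  Lambda s x <= sup (sensitivity_range T Lambda).
Proof. by move=> /sup_upper_bound + sT; apply; exists s => //; exists x. Qed.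

Lemma le_sup_kernel (R : realType) (T : R) (kappa : R -> R) tau :
  has_sup (kernel_range T kappa) -> tau \in `[0, T] ->
  kappa tau <= sup (kernel_range T kappa).
Proof. by move=> /sup_upper_bound + tT; apply; exists tau. Qed.

Lemma le_sup_norm (R : realType) (T : R) (f : R -> R) s :
  {within `[0, T], continuous f} -> s \in `[0, T] -> `|f s| <= sup_norm T f.
Proof.
move=> cf sT; have T0 : 0 <= T.
  by move: sT; rewrite in_itv/= => /andP[]; exact: le_trans.
have cnf : {within `[0, T], continuous (fun x => `|f x|)}.
  by move=> x; apply: continuous_comp; [exact: cf|exact: norm_continuous].
have [c cT fc] := EVT_max T0 cnf.
apply: sup_upper_bound; last by exists s.
split; first by exists `|f s|; exists s.
by exists `|f c| => _ [u uT <-]; exact: fc.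
Qed.

Lemma kernel_range_has_sup (R : realType) (T : R) (kappa : R -> R) :
  0 < T -> regular_kernel T kappa -> has_sup (kernel_range T kappa).
Proof.
move=> T0 [_ _ _ [m [M [_ kM]]] _ _]; split.
  by exists (kappa 0); exists 0 => //=; rewrite in_itv/= lexx ltW.
by exists M => _ [s sT <-]; have /andP[] := kM _ sT.
Qed.

Lemma sensitivity_range_has_sup (R : realType) (T : R) (Lambda : R -> R -> R) :
  0 < T -> adaptive_sensitivity T Lambda ->
  has_sup (sensitivity_range T Lambda).
Proof.
move=> T0 [_ [m [M [_ kM]]] _ _ _]; split.
  exists (Lambda 0 0); exists 0; first by rewrite /= in_itv/= lexx ltW.
  by exists 0.
by exists M => _ [s sT [x _ <-]]; have /andP[] := kM _ x sT.
Qed.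

(** * The memory integrand *)

Lemma memory_integrand_measurable (R : realType) (T : R) (kappa : R -> R)
    (Lambda : R -> R -> R) (f : R -> R) (t : R) :
  regular_kernel T kappa -> adaptive_sensitivity T Lambda ->
  {within `[0, T], continuous f} -> t \in `[0, T] ->
  lebesgue_measurable_on `[0, t] (memory_integrand kappa Lambda f t).
Proof.
move=> [_ _ _ _ _ [K K0 lipk]] [_ _ [L L0 lipL] mL _] cf.
rewrite in_itv/= => /andP[t0 tT].
have tsub : `[0, t] `<=` `[0, T] by apply: subset_itvl; rewrite bnd_simp.
have mt : @measurable _ (lebesgueType R) `[0, t].
  exact: lebesgue_measurable_borel.
have mT : @measurable _ (lebesgueType R) `[0, T].
  exact: lebesgue_measurable_borel.
have mf : lebesgue_measurable_on `[0, t] f.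
  apply: (measurable_funS mT tsub).
  apply: borel_lebesgue_measurable_fun => //.
  exact: subspace_continuous_measurable_fun.
have mLf : lebesgue_measurable_on `[0, t] (fun s => Lambda s (f s)).
  apply: (@measurable_fun_caratheodory _ (lebesgueType R) _ _ _ _ f L0 _ _ mf).
  - by move=> s x y /tsub; exact: lipL.
  - by move=> x; exact: (measurable_funS mT tsub (mL x)).
have mk : lebesgue_measurable_on `[0, t] (fun s => kappa (t - s)).
  apply: borel_lebesgue_measurable_fun => //.
  apply: (@measurable_fun_one_sided_lipschitz _ _ _ K) => x y x0 xy yt.
  rewrite -lerBlDl (le_trans (ler_norm _))//.
  have -> : y - x = `|(t - x) - (t - y)| by rewrite ger0_norm; lra.
  by apply: lipk; rewrite in_itv/=; apply/andP; split; lra.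
apply: measurable_funM; first exact: measurable_funM.
by apply: measurableT_comp mf; exact: normr_measurable.
Qed.

Lemma memory_integrand_ge0 (R : realType) (T : R) (kappa : R -> R)
    (Lambda : R -> R -> R) (f : R -> R) (t s : R) :
  regular_kernel T kappa -> adaptive_sensitivity T Lambda ->
  t \in `[0, T] -> s \in `[0, t] -> 0 <= memory_integrand kappa Lambda f t s.
Proof.
move=> [k0 _ _ _ _ _] [L0 _ _ _ _].
rewrite !in_itv/= => /andP[t0 tT] /andP[s0 st].
rewrite !mulr_ge0//; first by apply: L0; rewrite in_itv/=; lra.
by apply: k0; rewrite in_itv/=; lra.
Qed.

Lemma memory_integrand_le (R : realType) (T : R) (kappa : R -> R)
    (Lambda : R -> R -> R) (f : R -> R) (t s : R) :
  0 < T -> regular_kernel T kappa -> adaptive_sensitivity T Lambda ->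
  {within `[0, T], continuous f} ->
  t \in `[0, T] -> s \in `[0, t] ->
  memory_integrand kappa Lambda f t s <=
  sup (sensitivity_range T Lambda) * sup (kernel_range T kappa) * sup_norm T f.
Proof.
move=> T0 rk aL cf.
rewrite !in_itv/= => /andP[t0 tT] /andP[s0 st].
have sT : s \in `[0, T] by rewrite in_itv/=; lra.
have tsT : t - s \in `[0, T] by rewrite in_itv/=; lra.
have ? := as_ge0 aL (f s) sT; have ? := rk_ge0 rk tsT.
rewrite /memory_integrand ler_pM ?mulr_ge0//; last exact: le_sup_norm.
rewrite ler_pM//.
- exact/le_sup_sensitivity/sT/sensitivity_range_has_sup.
- exact/le_sup_kernel/tsT/kernel_range_has_sup.
Qed.

(** * The memory integral *)

Lemma integral_le_cst (R : realType) (a b c : R) (g : R -> R) :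
  a <= b -> lebesgue_measurable_on `[a, b] g ->
  (forall s, s \in `[a, b] -> 0 <= g s <= c) ->
  (\int[clebesgue R]_(s in `[a, b]) (g s)%:E <= (c * (b - a))%:E)%E.
Proof.
move=> ab mg gc.
have mab : @measurable _ (lebesgueType R) `[a, b].
  exact: lebesgue_measurable_borel.
have c0 : 0 <= c.
  have /andP[g0 gac] : 0 <= g a <= c by apply: gc; rewrite in_itv/= lexx.
  exact: le_trans g0 gac.
apply: (@le_trans _ _ (\int[clebesgue R]_(s in `[a, b]) (cst c%:E) s)%E).
  apply: ge0_le_integral => //.
  - by move=> s /gc /andP[].
  - exact/measurable_EFinP.
  - by move=> s /gc /andP[].
by rewrite integral_cst// EFinM -(clebesgue_itvcc ab).
Qed.

Lemma memory_integral_ge0 (R : realType) (T : R) (kappa : R -> R)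
    (Lambda : R -> R -> R) (f : R -> R) (t : R) :
  regular_kernel T kappa -> adaptive_sensitivity T Lambda ->
  t \in `[0, T] -> (0 <= memory_integral kappa Lambda f t)%E.
Proof.
move=> rk aL tT; apply: integral_ge0 => s st.
by rewrite lee_fin (memory_integrand_ge0 _ rk aL tT).
Qed.

Lemma memory_integral_le (R : realType) (T : R) (kappa : R -> R)
    (Lambda : R -> R -> R) (f : R -> R) (t : R) :
  0 < T -> regular_kernel T kappa -> adaptive_sensitivity T Lambda ->
  {within `[0, T], continuous f} -> t \in `[0, T] ->
  (memory_integral kappa Lambda f t <=
   (sup (sensitivity_range T Lambda) * sup (kernel_range T kappa) * T
    * sup_norm T f)%:E)%E.
Proof.
move=> T0 rk aL cf tT.
have [t0 tT'] : 0 <= t /\ t <= T by move: tT; rewrite in_itv/= => /andP.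
have bd s : s \in `[0, t] -> 0 <= memory_integrand kappa Lambda f t s <=
    sup (sensitivity_range T Lambda) * sup (kernel_range T kappa) *
    sup_norm T f.
  move=> st; rewrite (memory_integrand_ge0 _ rk aL tT)//.
  exact: memory_integrand_le.
apply: le_trans (integral_le_cst t0 _ bd) _.
  exact: memory_integrand_measurable rk aL cf tT.
rewrite lee_fin subr0 [leRHS]mulrAC ler_wpM2l//.
have /andP[g0 gc] := bd 0 ltac:(by rewrite in_itv/= lexx).
exact: le_trans g0 gc.
Qed.

Lemma memory_integral_fin_num (R : realType) (T : R) (kappa : R -> R)
    (Lambda : R -> R -> R) (f : R -> R) (t : R) :
  0 < T -> regular_kernel T kappa -> adaptive_sensitivity T Lambda ->
  {within `[0, T], continuous f} -> t \in `[0, T] ->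
  memory_integral kappa Lambda f t \is a fin_num.
Proof.
move=> T0 rk aL cf tT; rewrite ge0_fin_numE.
  by apply: le_lt_trans (memory_integral_le T0 rk aL cf tT) _; rewrite ltry.
exact: memory_integral_ge0 rk aL tT.
Qed.

Lemma memory_integrand_integrable (R : realType) (T : R) (kappa : R -> R)
    (Lambda : R -> R -> R) (f : R -> R) (t : R) :
  0 < T -> regular_kernel T kappa -> adaptive_sensitivity T Lambda ->
  {within `[0, T], continuous f} -> t \in `[0, T] ->
  (clebesgue R).-integrable `[0, t]
    (EFin \o memory_integrand kappa Lambda f t).
Proof.
move=> T0 rk aL cf tT; apply/integrableP; split.
  by apply/measurable_EFinP; exact: memory_integrand_measurable rk aL cf tT.
have J_oo : (memory_integral kappa Lambda f t < +oo)%E.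
  by rewrite ltey_eq (memory_integral_fin_num T0 rk aL cf tT).
apply: le_lt_trans J_oo; rewrite le_eqVlt; apply/orP; left; apply/eqP.
apply: eq_integral => s; rewrite inE => st /=.
by rewrite ger0_norm// (memory_integrand_ge0 _ rk aL tT).
Qed.

(** Going from x up to y changes the kernel by at most L * (y - x) on [0, x],
which costs at most K * (y - x), while the extra domain [x, y] contributes a
nonnegative amount, so it can be dropped from the right-hand side. *)
Lemma memory_integral_one_sided_lipschitz (R : realType) (T : R)
    (kappa : R -> R) (Lambda : R -> R -> R) (f : R -> R) :
  0 < T -> regular_kernel T kappa -> adaptive_sensitivity T Lambda ->
  {within `[0, T], continuous f} ->
  exists K, forall x y, 0 <= x -> x <= y -> y <= T ->
    (memory_integral kappa Lambda f x <=
     memory_integral kappa Lambda f y + (K * (y - x))%:E)%E.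
Proof.
move=> T0 rk aL cf; have [L L0 lipk] := rk_lipschitz rk.
set S := sup (sensitivity_range T Lambda); set F := sup_norm T f.
have S0 s : s \in `[0, T] -> 0 <= S.
  move=> sT; apply: le_trans (as_ge0 aL 0 sT) _.
  exact/le_sup_sensitivity/sT/sensitivity_range_has_sup.
(* One factor T is the bound for the length x of the domain. *)
exists (S * L * F * T) => x y x0 xy yT.
have xT : x \in `[0, T] by rewrite in_itv/=; lra.
have yT' : y \in `[0, T] by rewrite in_itv/=; lra.
have xsy : `[0, x] `<=` `[0, y] by apply: subset_itvl; rewrite bnd_simp.
have mx : @measurable _ (lebesgueType R) `[0, x].
  exact: lebesgue_measurable_borel.
have my : @measurable _ (lebesgueType R) `[0, y].
  exact: lebesgue_measurable_borel.
have F0 : 0 <= F by apply: le_trans (normr_ge0 _) (le_sup_norm cf xT).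
have c0 : 0 <= S * L * F * (y - x).
  by rewrite !mulr_ge0 ?(S0 x) ?subr_ge0// ltW.
have mgx := memory_integrand_measurable rk aL cf xT.
have mgy := memory_integrand_measurable rk aL cf yT'.
have mgyx : lebesgue_measurable_on `[0, x] (memory_integrand kappa Lambda f y).
  exact: measurable_funS my xsy mgy.
apply: (@le_trans _ _ (\int[clebesgue R]_(s in `[0%R, x])
  ((memory_integrand kappa Lambda f y s)%:E + (S * L * F * (y - x))%:E)%E)%E).
  apply: ge0_le_integral => //.
  - by move=> s sx; rewrite lee_fin (memory_integrand_ge0 _ rk aL xT).
  - exact/measurable_EFinP.
  - by apply: emeasurable_funD => //; exact/measurable_EFinP.
  move=> s /= sx; rewrite -EFinD lee_fin /memory_integrand.
  have sT : s \in `[0, T] by move: sx; rewrite !in_itv/=; lra.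
  have ? := as_ge0 aL (f s) sT.
  have LS : Lambda s (f s) <= S.
    exact/le_sup_sensitivity/sT/sensitivity_range_has_sup.
  have fF : `|f s| <= F by exact: le_sup_norm.
  rewrite -lerBlDl -mulrBl -mulrBr.
  have -> : S * L * F * (y - x) = S * (L * (y - x)) * F by ring.
  apply: (@le_trans _ _ (Lambda s (f s) * (L * (y - x)) * `|f s|)).
    rewrite ler_wpM2r// ler_wpM2l//.
    rewrite (le_trans (ler_norm _))// distrC.
    have -> : y - x = `|(y - s) - (x - s)| by rewrite ger0_norm; lra.
    by apply: lipk; move: sx; rewrite !in_itv/=; lra.
  have ? : 0 <= L * (y - x) by rewrite mulr_ge0 ?subr_ge0// ltW.
  by apply: ler_pM => //; [exact: mulr_ge0|exact: ler_wpM2r].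
rewrite ge0_integralD//; last 2 first.
- move=> s sx; rewrite lee_fin (memory_integrand_ge0 _ rk aL yT')//.
  exact: xsy.
- exact/measurable_EFinP.
apply: leeD.
  apply: ge0_subset_integral => //; first exact/measurable_EFinP.
  by move=> s sy; rewrite lee_fin (memory_integrand_ge0 _ rk aL yT').
apply: le_trans (@integral_le_cst _ 0 x (S * L * F * (y - x)) _ x0 _ _) _.
- exact: measurable_cst.
- by move=> s _; rewrite c0 lexx.
rewrite lee_fin subr0 [leRHS]mulrAC ler_wpM2l//; lra.
Qed.

Lemma memory_integral_measurable (R : realType) (T : R) (kappa : R -> R)
    (Lambda : R -> R -> R) (f : R -> R) :
  0 < T -> regular_kernel T kappa -> adaptive_sensitivity T Lambda ->
  {within `[0, T], continuous f} ->
  lebesgue_emeasurable_on `[0, T] (memory_integral kappa Lambda f).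
Proof.
move=> T0 rk aL cf; apply: borel_lebesgue_measurable_fun => //.
have [K J_lip] := memory_integral_one_sided_lipschitz T0 rk aL cf.
have finJ t : t \in `[0, T] -> memory_integral kappa Lambda f t \is a fin_num.
  exact: memory_integral_fin_num.
apply: (eq_measurable_fun (EFin \o (fine \o memory_integral kappa Lambda f))).
  by move=> t; rewrite inE => /finJ /fineK.
apply/measurable_EFinP.
apply: (@measurable_fun_one_sided_lipschitz _ _ _ K) => x y x0 xy yT.
rewrite -lee_fin EFinD !fineK ?J_lip//; apply: finJ; rewrite in_itv/=; lra.
Qed.

Theorem lemma4p1 (R : realType) (T : R) (kappa : R -> R)
    (Lambda : R -> R -> R)
    (T_gt0 : 0 < T)
    (kappa_reg : regular_kernel T kappa)
    (Lambda_adapt : adaptive_sensitivity T Lambda) :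
  let J := memory_integral kappa Lambda in
  let M := memory_operator kappa Lambda in
  let Lambda_oo := sup (sensitivity_range T Lambda) in
  let kappa_oo := sup (kernel_range T kappa) in
  (* (i) *)
  (forall f : R -> R, {within `[0, T], continuous f} ->
     forall t, t \in `[0, T] ->
       [/\ (clebesgue R).-integrable `[0, t]
             (EFin \o memory_integrand kappa Lambda f t),
           J f t \is a fin_num, (0 <= J f t)%E,
           M f t \is a fin_num & (0 <= M f t)%E]) /\
  (* (ii) *)
  (forall f : R -> R, {within `[0, T], continuous f} ->
     lebesgue_emeasurable_on `[0, T] (J f) /\
     lebesgue_emeasurable_on `[0, T] (M f)) /\
  (* (iii): C is chosen before f and t *)
  (exists2 C : R, 0 < C &
     forall f : R -> R, {within `[0, T], continuous f} ->
       forall t, t \in `[0, T] -> (M f t <= (C * sup_norm T f)%:E)%E) /\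
  (has_sup (sensitivity_range T Lambda) /\
   forall lmin lmax, sensitivity_bounds T Lambda lmin lmax ->
     Lambda_oo <= lmax) /\
  (has_sup (kernel_range T kappa) /\
   forall m_kappa M_kappa, kernel_bounds T kappa m_kappa M_kappa ->
     kappa_oo <= M_kappa) /\
  0 < 1 + Lambda_oo * kappa_oo * T /\
  (forall f : R -> R, {within `[0, T], continuous f} ->
     forall t, t \in `[0, T] ->
       (M f t <= ((1 + Lambda_oo * kappa_oo * T) * sup_norm T f)%:E)%E /\
       (J f t <= (Lambda_oo * kappa_oo * T * sup_norm T f)%:E)%E).
Proof.
move=> J M Lambda_oo kappa_oo.
have J_fin f t : {within `[0, T], continuous f} -> t \in `[0, T] ->
    J f t \is a fin_num by exact: memory_integral_fin_num.
have J_ge0 f t : t \in `[0, T] -> (0 <= J f t)%E.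
  exact: memory_integral_ge0 kappa_reg Lambda_adapt.
have J_le f t : {within `[0, T], continuous f} -> t \in `[0, T] ->
    (J f t <= (Lambda_oo * kappa_oo * T * sup_norm T f)%:E)%E.
  exact: memory_integral_le.
have M_le f t : {within `[0, T], continuous f} -> t \in `[0, T] ->
    (M f t <= ((1 + Lambda_oo * kappa_oo * T) * sup_norm T f)%:E)%E.
  move=> cf tT; rewrite mulrDl mul1r EFinD leeD ?J_le//.
  by rewrite lee_fin le_sup_norm.
have Lambda_sup := sensitivity_range_has_sup T_gt0 Lambda_adapt.
have kappa_sup := kernel_range_has_sup T_gt0 kappa_reg.
have T0 : 0 \in `[0, T] by rewrite in_itv/= lexx ltW.
have C_gt0 : 0 < 1 + Lambda_oo * kappa_oo * T.
  rewrite ltr_pwDl// !mulr_ge0 ?ltW//.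
  - apply: lt_le_trans (le_sup_sensitivity 0 Lambda_sup T0).
    by have [rho rho0 /(_ _ T0)] := as_nondegenerate Lambda_adapt; lra.
  - apply: lt_le_trans (le_sup_kernel kappa_sup T0).
    by have [m [Mk [/andP[m0 _] /(_ _ T0)]]] := rk_bounds kappa_reg; lra.
split; [|split; [|split; [|split; [|split; [|split]]]]] => //.
- move=> f cf t tT; split.
  + exact: memory_integrand_integrable T_gt0 kappa_reg Lambda_adapt cf tT.
  + exact: J_fin.
  + exact: J_ge0.
  + by rewrite fin_numD J_fin.
  + by rewrite adde_ge0// J_ge0.
- move=> f cf.
  have mJ := memory_integral_measurable T_gt0 kappa_reg Lambda_adapt cf.
  split=> //; apply: emeasurable_funD => //.
  apply: borel_lebesgue_measurable_fun => //; apply/measurable_EFinP.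
  apply: measurableT_comp; first exact: normr_measurable.
  exact: subspace_continuous_measurable_fun.
- by exists (1 + Lambda_oo * kappa_oo * T) => // f cf t tT; exact: M_le.
- split=> // lmin lmax [_ bd]; apply: ge_sup; first by case: Lambda_sup.
  by move=> _ [s sT [x _ <-]]; have /andP[] := bd _ x sT.
- split=> // m Mk [_ bd]; apply: ge_sup; first by case: kappa_sup.
  by move=> _ [s sT <-]; have /andP[] := bd _ sT.
- by move=> f cf t tT; split; [exact: M_le|exact: J_le].
Qed.
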